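(* For every positive integer $d$, the following statements are equivalent: (a) There exists an $\varepsilon_d>0$ such that for any $\varepsilon$ with $0<\varepsilon\le\varepsilon_d$ (and $\varepsilon<2$), we have $\chi_b(BS(d,\varepsilon))=d+1$. (b) For every cover of $S^d$ by antipodally symmetric open sets $A_1,A_2,\dots,A_d$, one of the $A_i$'s connects (hence path-connects) a pair of antipodal points. (c1) For every cover of $S^d$ by antipodally symmetric closed sets $F_1,F_2,\dots,F_d$, there is an $F_i$ such that any open neighbourhood $U$ of $F_i$ connects a pair of antipodal points. (c2) For every cover of $S^d$ by antipodally symmetric closed sets $F_1,F_2,\dots,F_d$, one of the $F_i$'s connects a pair of antipodal points.
   Context: $S^d=\{x\in\mathbb{R}^{d+1}:\|x\|_2=1\}$, and $\mathrm{dist}$ denotes the Euclidean distance in $\mathbb{R}^{d+1}$. A subset $C\subseteq S^d$ is (antipodally) symmetric if $-C=C$. A subset $Y\subseteq S^d$ connects two points of $Y$ if they lie in the same connected component of $Y$; it path-connects them if there is a continuous path in $Y$ from one to the other. ''Connects a pair of antipodal points'' means that there is $x$ with $x,-x\in Y$ lying in the same connected component of $Y$. A signed graph $(G,\sigma)$ is a (possibly infinite) graph $G$ (loops and parallel edges allowed) with a signature $\sigma:E(G)\to\{-1,+1\}$; an edge is positive or negative according to its sign. Switching a set $X$ of vertices means flipping the signs of all edges with exactly one end in $X$. $(G,\sigma)$ is balanced if some switching makes all edges positive (equivalently, every cycle has an even number of negative edges). A set $X\subseteq V(G)$ is balanced if the signed subgraph induced by $X$ is balanced. A balanced $p$-colouring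 is a map $f:V(G)\to\{1,\dots,p\}$ such that every $f^{-1}(i)$ is balanced, and $\chi_b(G,\sigma)$ is the minimum $p$ for which a balanced $p$-colouring exists. For $0<\varepsilon<2$, the Borsuk signed graph $BS(d,\varepsilon)$ is the signed graph on the vertex set $S^d$ in which, for any $x,y\in S^d$, there is a positive edge joining $x$ and $y$ if $\mathrm{dist}(x,y)\le\varepsilon$, and a negative edge joining them if $\mathrm{dist}(x,-y)\le\varepsilon$ (positive loops are irrelevant to balance). *)

(* Defs.v *)
From HB Require Import structures.
From mathcomp Require Import all_boot all_order all_algebra.
From mathcomp Require Import all_classical all_reals all_analysis.

Set Implicit Arguments.
Unset Strict Implicit.
Unset Printing Implicit Defensive.

Import Order.TTheory GRing.Theory Num.Theory.
Import numFieldNormedType.Exports.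

Local Open Scope classical_set_scope.
Local Open Scope ring_scope.

                                                                        
                                                                               
Definition l2norm (R : realType) (n : nat) (x : 'rV[R]_n) : R :=
  Num.sqrt (\sum_(i < n) x 0 i ^+ 2).

Definition l2dist (R : realType) (n : nat) (x y : 'rV[R]_n) : R :=
  l2norm (x - y).

Definition unit_sphere (R : realType) (d : nat) : set 'rV[R]_d.+1 :=
  [set x | l2norm x = 1].
Arguments unit_sphere : clear implicits.

                                                                         
                                        
Definition open_in (T : topologicalType) (S A : set T) : Prop :=
  A `<=` S /\ open (A : set (subspace S)).

Definition closed_in (T : topologicalType) (S A : set T) : Prop :=
  A `<=` S /\ closed (A : set (subspace S)).

Definition antipodally_symmetric (V : zmodType) (C : set V) : Prop :=
  [set - x | x in C] = C.

Definition sphere_cover (R : realType) (d k : nat)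
    (A : 'I_k -> set 'rV[R]_d.+1) : Prop :=
  \bigcup_i A i = unit_sphere R d.

                                                                           
                      
Definition connects (T : topologicalType) (Y : set T) (x y : T) : Prop :=
  connected_component Y x y.

Definition path_connects (R : realType) (T : topologicalType) (Y : set T)
    (x y : T) : Prop :=
  exists gamma : R -> T,
    [/\ {within `[0, 1], continuous gamma}, gamma 0 = x, gamma 1 = y
      & gamma @` `[0, 1] `<=` Y].

Definition connects_antipodal_pair (R : realType) (n : nat)
    (Y : set 'rV[R]_n) : Prop :=
  exists x, connects Y x (- x).

                                                                    
                                                                        
Record signed_graph := SignedGraph {
  vertex : Type;
  edge : Type;
  ends : edge -> set vertex;
  negative : edge -> bool;
  endsP : forall e, exists x y, ends e = [set x; y]
}.

Definition exactly_one_end_in (G : signed_graph) (X : set (vertex G))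
    (e : edge G) : Prop :=
  (ends e `&` X) !=set0 /\ (ends e `\` X) !=set0.

Definition switch (G : signed_graph) (X : set (vertex G)) : signed_graph :=
  @SignedGraph (vertex G) (edge G) (@ends G)
    (fun e => negative e (+) `[< exactly_one_end_in X e >]) (@endsP G).

Definition all_positive (G : signed_graph) : Prop :=
  forall e : edge G, ~~ negative e.

Definition balanced (G : signed_graph) : Prop :=
  exists X : set (vertex G), all_positive (switch X).

Section Induced.
Variables (G : signed_graph) (X : set (vertex G)).

Let iV := {v : vertex G | X v}.
Let iE := {e : edge G | ends e `<=` X}.

Lemma induced_endsP (e : iE) :
  exists x y : iV, (fun v : iV => ends (sval e) (sval v)) = [set x; y].
Proof.
have [x [y exy]] := endsP (sval e).
have Xx : X x by apply: (svalP e); rewrite exy; left.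
have Xy : X y by apply: (svalP e); rewrite exy; right.
exists (exist _ x Xx), (exist _ y Xy); rewrite exy.
apply/seteqP; split=> -[v Xv] /=.
- by move=> [] vE; [left|right]; exact: eq_exist.
- by move=> [] /(congr1 sval) /= ->; [left|right].
Qed.

Definition induced : signed_graph :=
  @SignedGraph iV iE (fun e v => ends (sval e) (sval v))
    (fun e => negative (sval e)) induced_endsP.

End Induced.

Definition balanced_set (G : signed_graph) (X : set (vertex G)) : Prop :=
  balanced (induced X).

Definition balanced_colouring (G : signed_graph) (p : nat)
    (f : vertex G -> 'I_p) : Prop :=
  forall i : 'I_p, balanced_set (f @^-1` [set i]).

Definition balanced_colourable (G : signed_graph) (p : nat) : Prop :=
  exists f : vertex G -> 'I_p, balanced_colouring f.

                                                                            
                                              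
Definition balanced_chromatic_number (G : signed_graph) (p : nat) : Prop :=
  balanced_colourable G p /\
  forall q : nat, balanced_colourable G q -> (p <= q)%N.

Section BorsukSignedGraph.
Variables (R : realType) (d : nat) (eps : R).

Definition sphere_point := {x : 'rV[R]_d.+1 | unit_sphere R d x}.

                                                                      
                                                                               
Definition borsuk_edge_spec (e : bool * set sphere_point) : Prop :=
  exists x y : sphere_point,
    e.2 = [set x; y] /\
    if e.1 then l2dist (sval x) (- sval y) <= eps
    else l2dist (sval x) (sval y) <= eps.

Definition borsuk_edge := {e : bool * set sphere_point | borsuk_edge_spec e}.

Lemma borsuk_endsP (e : borsuk_edge) : exists x y, (sval e).2 = [set x; y].
Proof. by have [x [y [exy _]]] := svalP e; exists x, y. Qed.

Definition borsuk_signed_graph : signed_graph :=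
  @SignedGraph sphere_point borsuk_edge (fun e => (sval e).2)
    (fun e => (sval e).1) borsuk_endsP.

End BorsukSignedGraph.
Arguments borsuk_signed_graph {R} d eps.

(* Main.v *)
Require Import Defs.
From HB Require Import structures.
From mathcomp Require Import all_boot all_order all_algebra.
From mathcomp Require Import all_classical all_reals all_analysis.
From mathcomp Require Import ring lra.

(** The bridge between colourings and covers is the following observation. A
    set of vertices of the Borsuk signed graph is balanced when each of its
    points can be given a sign so that points at distance at most [eps] have
    equal signs and points that are nearly antipodal have opposite signs
    ([borsuk_colourableP]).

    (a) implies (b). Let symmetric open sets [A i] cover the sphere, none of
    them connecting an antipodal pair. In each [A i] the components come in
    disjoint pairs of opposite sets, and choosing one component from each pair
    gives an odd function [s i], constant on components ([antipodal_sign]). If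
    [eps] is below a Lebesgue number of the cover, a point can be coloured by
    an [i] such that a whole cap around it lies in [A i]; nearby points are
    then joined by an arc inside [A i], so the signs [s i] balance the colour
    classes. Hence [d] colours suffice for all small [eps]
    ([sphere_cover_colourable]), against (a).

    (b) implies (c1): intersect each bad neighbourhood [U] with [- U].

    (c1) implies (c2): a compact symmetric [F] that does not connect an
    antipodal pair has a neighbourhood that does not either
    ([closed_in_nbhs_disconnects]). This rests on the fact that in a compact
    set two points of different components lie on different sides of a cut
    into two pieces at positive distance ([compact_disconnects_gap]); such a
    cut survives a small thickening of [F], and compactness of the sphere makes
    the thickness uniform.

    (c2) implies (a). From a balanced colouring with [d] colours, flip every
    point of negative sign to its antipode: in each colour, the resulting set
    [P] is at distance more than [eps] from [- P]. The closures of [P] and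
    [- P] together form a closed symmetric set in which antipodal points are
    separated, and these sets cover the sphere ([colourable_closed_cover]), so
    (c2) fails. Conversely [d.+1] colours always suffice for small [eps]: colour
    a point by a coordinate that is large in absolute value
    ([borsuk_colourable]).

    Finally, small caps are path connected ([sphere_path]), so open subsets of
    the sphere are locally path connected and their components are path
    connected ([open_in_connects_path_connects]). *)

Set Implicit Arguments.
Unset Strict Implicit.
Unset Printing Implicit Defensive.

Import Order.TTheory GRing.Theory Num.Theory.
Import numFieldNormedType.Exports.

Local Open Scope classical_set_scope.
Local Open Scope ring_scope.

(** * The Euclidean norm on row vectors *)

Section L2norm.
Variables (R : realType) (n : nat).
Implicit Types x y z : 'rV[R]_n.

Lemma l2norm_ge0 x : 0 <= l2norm x.
Proof. exact: sqrtr_ge0. Qed.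

Lemma sqr_l2norm x : l2norm x ^+ 2 = \sum_(i < n) x 0 i ^+ 2.
Proof. by rewrite sqr_sqrtr// sumr_ge0// => i _; exact: sqr_ge0. Qed.

Lemma l2normZ (a : R) x : l2norm (a *: x) = `|a| * l2norm x.
Proof.
rewrite /l2norm -sqrtr_sqr -sqrtrM ?sqr_ge0// mulr_sumr.
by congr Num.sqrt; apply: eq_bigr => i _; rewrite !mxE exprMn.
Qed.

Lemma l2normN x : l2norm (- x) = l2norm x.
Proof. by rewrite -scaleN1r l2normZ normrN1 mul1r. Qed.

Lemma coord_le_l2norm x (i : 'I_n) : `|x 0 i| <= l2norm x.
Proof.
rewrite -sqrtr_sqr ler_wsqrtr// (bigD1 i)//= lerDl sumr_ge0// => j _.
exact: sqr_ge0.
Qed.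

Lemma norm_le_l2norm x : `|x| <= l2norm x.
Proof.
rewrite {1}/Num.norm/= mx_normrE; apply/bigmax_leP.
split; first exact: l2norm_ge0.
by move=> [i j] _ /=; rewrite (ord1 i); exact: coord_le_l2norm.
Qed.

Lemma coord_le_norm x (i : 'I_n) : `|x 0 i| <= `|x|.
Proof.
rewrite [leRHS]/Num.norm/= mx_normrE.
by apply/bigmax_geP; right; exists (0, i).
Qed.

Lemma l2norm_le_norm x : l2norm x <= n%:R * `|x|.
Proof.
rewrite -(@ler_pXn2r _ 2)// ?nnegrE ?l2norm_ge0 ?mulr_ge0// sqr_l2norm.
apply: (@le_trans _ _ (\sum_(i < n) `|x| ^+ 2)).
  apply: ler_sum => i _; rewrite -[leLHS]real_normK ?num_real//.
  by rewrite lerXn2r ?nnegrE// coord_le_norm.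
rewrite sumr_const card_ord -[leLHS]mulr_natl exprMn ler_wpM2r ?sqr_ge0//.
by rewrite -natrX ler_nat; case: (n) => // m; rewrite leq_pmull.
Qed.

(** The square of [l2norm (l2norm y *: x - l2norm x *: y)] is nonnegative;
    expanded, it bounds the scalar product by the product of the norms. *)
Lemma l2norm_cauchy_schwarz x y :
  \sum_(i < n) x 0 i * y 0 i <= l2norm x * l2norm y.
Proof.
have [x0|x0] := eqVneq (l2norm x) 0.
  rewrite x0 mul0r big1// => i _.
  have := coord_le_l2norm x i; rewrite x0 normr_le0 => /eqP ->.
  by rewrite mul0r.
have [y0|y0] := eqVneq (l2norm y) 0.
  rewrite y0 mulr0 big1// => i _.
  have := coord_le_l2norm y i; rewrite y0 normr_le0 => /eqP ->.
  by rewrite mulr0.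
set a := l2norm x; set b := l2norm y; set s := \sum_(i < n) _.
have a0 : 0 < a by rewrite lt_neqAle eq_sym x0 l2norm_ge0.
have b0 : 0 < b by rewrite lt_neqAle eq_sym y0 l2norm_ge0.
have : 0 <= \sum_(i < n) (b * x 0 i - a * y 0 i) ^+ 2.
  by apply: sumr_ge0 => i _; exact: sqr_ge0.
have -> : \sum_(i < n) (b * x 0 i - a * y 0 i) ^+ 2 =
    b ^+ 2 * a ^+ 2 - (2 * a * b) * s + a ^+ 2 * b ^+ 2.
  rewrite [X in _ * X - _](sqr_l2norm x) [X in _ + _ * X](sqr_l2norm y).
  rewrite !mulr_sumr -sumrB -big_split/=.
  by apply: eq_bigr => i _; ring.
have -> : b ^+ 2 * a ^+ 2 - 2 * a * b * s + a ^+ 2 * b ^+ 2 =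
   (2 * (a * b)) * (a * b - s) by ring.
by rewrite pmulr_rge0 ?subr_ge0// !mulr_gt0.
Qed.

Lemma ler_l2normD x y : l2norm (x + y) <= l2norm x + l2norm y.
Proof.
rewrite -(@ler_pXn2r _ 2)// ?nnegrE ?addr_ge0 ?l2norm_ge0//.
rewrite sqrrD !sqr_l2norm.
have -> : \sum_(i < n) (x + y) 0 i ^+ 2 = \sum_(i < n) x 0 i ^+ 2 +
    (\sum_(i < n) x 0 i * y 0 i) *+ 2 + \sum_(i < n) y 0 i ^+ 2.
  rewrite -sumrMnl -!big_split/=; apply: eq_bigr => i _.
  by rewrite mxE sqrrD.
by rewrite lerD2r lerD2l lerMn2r/= l2norm_cauchy_schwarz.
Qed.

Lemma l2distC x y : l2dist x y = l2dist y x.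
Proof. by rewrite /l2dist -opprB l2normN. Qed.

Lemma l2distxx x : l2dist x x = 0.
Proof. by rewrite /l2dist subrr -(scale0r x) l2normZ normr0 mul0r. Qed.

Lemma l2distNN x y : l2dist (- x) (- y) = l2dist x y.
Proof. by rewrite l2distC /l2dist opprK addrC. Qed.

Lemma l2dist_triangle y x z : l2dist x z <= l2dist x y + l2dist y z.
Proof. by rewrite /l2dist -(subrKA y x) ler_l2normD. Qed.

Lemma ler_l2dist_dist x y : `|l2norm x - l2norm y| <= l2dist x y.
Proof.
have := ler_l2normD (x - y) y; have := ler_l2normD (y - x) x.
rewrite !subrK -/(l2dist x y) -/(l2dist y x) (l2distC y x) ler_norml => *.
by apply/andP; split; lra.
Qed.

Lemma l2norm_continuous : continuous (@l2norm R n).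
Proof.
move=> x; apply/(@cvgrPdist_lt _ _ _ (nbhs x)) => e e0; near=> y.
apply: (le_lt_trans (ler_l2dist_dist x y)).
apply: (le_lt_trans (l2norm_le_norm (x - y))).
have n0 : 0 < n.+1%:R :> R by [].
apply: (@le_lt_trans _ _ (n.+1%:R * `|x - y|)).
  by rewrite ler_wpM2r// ler_nat.
rewrite mulrC -ltr_pdivlMr//; near: y.
apply: (@cvgr_dist_lt _ _ _ (nbhs x) _ id x); [exact: cvg_id|exact: divr_gt0].
Unshelve. all: by end_near. Qed.

Lemma near_l2dist_lt x (e : R) : 0 < e -> \forall y \near x, l2dist x y < e.
Proof.
move=> e0; have : l2dist x y @[y --> x] --> l2dist x x.
  apply: (@continuous_comp _ _ _ (fun y => x - y) (@l2norm R n)).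
    by apply: (@cvgB _ _ _ (nbhs x)); [exact: cvg_cst|exact: cvg_id].
  exact: l2norm_continuous.
by rewrite l2distxx => /cvgr_lt; exact.
Qed.

End L2norm.

(** * Compactness of the sphere *)

Section Sphere.
Variables (R : realType) (d : nat).
Local Notation S := (unit_sphere R d).

Lemma unit_sphereN x : S x -> S (- x).
Proof. by rewrite /unit_sphere/= l2normN. Qed.

Lemma closed_sphere : closed S.
Proof.
have -> : S = @l2norm R d.+1 @^-1` [set 1] by [].
by apply: closed_comp => [x _|]; [exact: l2norm_continuous|exact: closed_eq].
Qed.

Lemma compact_sphere : compact S.
Proof.
apply: bounded_closed_compact; last exact: closed_sphere.
exists 1; split => // M M1 x Sx /=.
by rewrite (le_trans (norm_le_l2norm x))// Sx ltW.
Qed.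

End Sphere.

(** * Sets at positive distance *)

Section Gap.
Variables (R : realType) (V : normedModType R).
Implicit Types (A B C K Y : set V) (e : R).

Definition gap e A B := forall a b, A a -> B b -> e <= `|a - b|.

Definition thicken e A := [set z : V | exists2 a, A a & `|z - a| < e].

Lemma gapC e A B : gap e A B -> gap e B A.
Proof. by move=> g a b Ba Ab; rewrite distrC; exact: g. Qed.

Lemma sub_thicken e A : 0 < e -> A `<=` thicken e A.
Proof. by move=> e0 a Aa; exists a; rewrite // subrr normr0. Qed.

Lemma open_thicken e A : open (thicken e A).
Proof.
rewrite (_ : thicken e A = \bigcup_(a in A) ball a e).
  by apply: bigcup_open => a _; exact: ball_open.
apply/seteqP; split => [z [a Aa za]|z [a Aa za]]; exists a => //.
  by rewrite -ball_normE/= distrC.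
by rewrite distrC; move: za; rewrite -ball_normE.
Qed.

Lemma gap_thicken e A B :
  gap (e *+ 3) A B -> gap e (thicken e A) (thicken e B).
Proof.
move=> g z w [a Aa za] [b Bb wb].
have := g _ _ Aa Bb; have := ler_distD z a b; have := ler_distD w z b.
move: za wb; rewrite (distrC a z) mulrS mulr2n; lra.
Qed.

Lemma gap_closure e A B : gap e A B -> gap e (closure A) (closure B).
Proof.
move=> g x y xA yB; rewrite leNgt; apply/negP => xye.
pose r := (e - `|x - y|) / 2.
have r0 : 0 < r by rewrite divr_gt0// subr_gt0.
have [a []] := xA _ (nbhsx_ballx x r r0).
have [b []] := yB _ (nbhsx_ballx y r r0).
rewrite -!ball_normE/= => Bb yb Aa xa; have := g _ _ Aa Bb.
have := ler_distD x a b; have := ler_distD y x b.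
move: xa yb; rewrite (distrC a x) /r; lra.
Qed.

(** A connected set cannot jump over a gap. *)
Lemma gap_disconnects e A B Y x y : 0 < e -> gap e A B ->
  Y `<=` A `|` B -> A x -> B y -> ~ connects Y x y.
Proof.
move=> e0 g YAB Ax By [C [Cx CY Cc] Cy].
have h A' B' : gap e A' B' -> closure A' `&` B' = set0.
  move=> g'; rewrite -subset0 => z [zA zB].
  have := gap_closure g' zA (subset_closure zB).
  by rewrite subrr normr0 leNgt e0.
have sep : separated A B.
  by split; [exact: h|rewrite setIC; apply: h; exact: gapC].
have AB z : A z -> B z -> False.
  by move=> Az Bz; have := g _ _ Az Bz; rewrite subrr normr0 leNgt e0.
have [CA|CB] := connected_subset sep (subset_trans CY YAB) Cc.
  exact: AB (CA _ Cy) By.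
exact: AB Ax (CB _ Cx).
Qed.

(** Each point of [A] has a ball disjoint from [B]; compactness of [A] makes
    the radius uniform. *)
Lemma compact_gap A B : compact A -> closed B -> A `&` B = set0 ->
  exists2 e, 0 < e & gap e A B.
Proof.
move=> cA cB AB.
have /(_ R (0^'+) (fun e a => forall b, B b -> e <= `|a - b|) _) :=
  (compact_near_coveringP A).1 cA.
have h a : A a -> \forall a' \near a & e \near (0:R)^'+,
    forall b, B b -> e <= `|a' - b|.
  move=> Aa; have : nbhs a (~` B).
    apply: open_nbhs_nbhs; split; first exact: closed_openC.
    by move=> Ba; have : (A `&` B) a by []; rewrite AB.
  move=> /nbhs_ballP[r /= r0 rB].
  have r20 : 0 < r / 2 by rewrite divr_gt0.
  near=> a' e => b Bb; rewrite leNgt; apply/negP => a'b.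
  apply: (rB b) => //; rewrite -ball_normE/=.
  have aa' : `|a - a'| < r / 2.
    by near: a'; exact: (@cvgr_dist_lt _ _ _ (nbhs a) _ id a).
  have er : e < r / 2 by near: e; exact: nbhs_right_lt.
  have := ler_distD a' a b; move: a'b aa' er => /=; lra.
move=> /(_ h) H; near (0:R)^'+ => e; exists e => //.
have He : A `<=` (fun a => forall b, B b -> e <= `|a - b|) by near: e.
by move=> a b /He; exact.
Unshelve. all: by end_near. Qed.

End Gap.

(** * Components of compact sets *)

Section QuasiComponent.
Variables (R : realType) (V : normedModType R) (K : set V).
Implicit Types (x y : V) (e : R).

Definition cut e x (D : set V) := [/\ D `<=` K, D x & gap e D (K `\` D)].

(** For [x] in [K], the points reached from [x] by chains of steps shorter than [e]:
    they form the smallest side of a cut of width [e]. Describing the set by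
    cuts avoids handling the chains themselves. *)
Definition chain_component e x := \bigcap_(D in cut e x) D.

Definition quasi_component x :=
  \bigcap_(e in [set e | 0 < e]) chain_component e x.

Lemma cut_self e x : K x -> cut e x K.
Proof. by move=> Kx; split => // a b _ []. Qed.

Lemma cut_anti e e' x D : e' <= e -> cut e x D -> cut e' x D.
Proof.
move=> ee' [DK Dx g]; split=> // a b Da Kb.
exact: le_trans ee' (g _ _ Da Kb).
Qed.

(** A single cut of width [e] already tells a point outside the chain component
    from all points inside. *)
Lemma gap_chain_component e x :
  gap e (chain_component e x) (K `\` chain_component e x).
Proof.
move=> a b Ca [Kb Cb]; have [D [cD /= Db]] : exists D, cut e x D /\ ~ D b.
  apply: contrapT => h; apply: Cb => D cD.
  by apply: contrapT => Db; apply: h; exists D.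
by case: (cD) => _ _; apply => //; exact: Ca.
Qed.

Lemma quasi_component_sub x : K x -> quasi_component x `<=` K.
Proof. by move=> Kx q Qq; apply: (Qq 1 ltr01 K); exact: cut_self. Qed.

Lemma closed_quasi_component x : K x -> closed K -> closed (quasi_component x).
Proof.
move=> Kx cK z Qz e /= e0 D cD; apply: contrapT => Dz.
have Kz : K z.
  by apply: cK; apply: closureS Qz; exact: quasi_component_sub.
have [q [Qq]] := Qz _ (nbhsx_ballx z e e0).
rewrite -ball_normE/= => qz; case: (cD) => _ _ /(_ q z (Qq _ e0 _ cD)).
by move=> /(_ (conj Kz Dz)); rewrite distrC leNgt qz.
Qed.

(** Suppose that the quasi-component [Q] of [x] splits into two closed parts,
    with [x] in [E b]. The parts are at positive distance, so they have
    disjoint thickenings [U] and [W]. No point of [K] outside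
    [U] and [W] is in [Q]; these points form a compact set, so for some width
    [e] the chain component of width [e] misses all of them. Then its part inside [U] is one side of a cut, hence
    contains [Q]; so the other part of [Q] is empty. *)
Lemma connected_quasi_component x : compact K -> K x ->
  connected (quasi_component x).
Proof.
move=> cK Kx.
have clK : closed K.
  by apply: compact_closed => //; exact: norm_hausdorff.
set Q := quasi_component x.
have QK : Q `<=` K by exact: quasi_component_sub.
have Qx : Q x by move=> e _ D [].
have clQ : closed Q by exact: closed_quasi_component.
apply/connectedP => E [E0 QE sepE].
have sub b : E b `<=` Q by rewrite QE; case: b => z Ez; [right|left].
have disj b z : closure (E b) z -> E (~~ b) z -> False.
  case: b sepE => -[s1 s2] c1 c2.
    by have : (E false `&` closure (E true)) z by []; rewrite s2.
  by have : (closure (E false) `&` E true) z by []; rewrite s1.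
have clE b : closed (E b).
  move=> z Ez; have : Q z by apply: clQ; exact: closureS Ez.
  have := disj b z Ez; rewrite QE; case: b {Ez} => /= h [] //.
have cpE b : compact (E b).
  by apply: subclosed_compact cK _ => //; exact: subset_trans (sub b) QK.
have [b Ebx] : exists b, E b x.
  by move: Qx; rewrite QE => -[]; [exists false|exists true].
have [y Ey] := E0 (~~ b).
have [r r0 g] : exists2 e, 0 < e & gap e (E b) (E (~~ b)).
  apply: compact_gap => //; rewrite -subset0 => z [z1 z2].
  by apply: (disj b z) => //; exact: subset_closure.
(* dividing by 3 leaves a gap of width [s] between the [s]-thickenings *)
pose s := r / 3; have s0 : 0 < s by rewrite divr_gt0.
have {}g : gap (s *+ 3) (E b) (E (~~ b)).
  by rewrite -[s *+ 3]mulr_natr divfK.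
set U := thicken s (E b); set W := thicken s (E (~~ b)).
have cM : compact (K `&` ~` (U `|` W)).
  apply: subclosed_compact cK _; last by move=> z [].
  apply: closedI => //; apply: open_closedC; apply: openU; exact: open_thicken.
have /(_ R (0^'+) (fun e m => ~ chain_component e x m) _) :=
  (near_covering_withinP _).2 ((compact_near_coveringP _).1 cM).
have h m : (K `&` ~` (U `|` W)) m -> \forall m' \near m & e \near (0:R)^'+,
    (K `&` ~` (U `|` W)) m' -> ~ chain_component e x m'.
  move=> [Km UWm].
  have [e [D [e0 cD Dm]]] : exists e D, [/\ 0 < e, cut e x D & ~ D m].
    apply: contrapT => h; apply: UWm.
    have : Q m.
      by move=> e e0 D cD; apply: contrapT => Dm; apply: h; exists e, D.
    rewrite QE => -[] Em; case: b @U @W {Ebx Ey g cM h} => U W;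
      [right|left|left|right]; exact: sub_thicken.
  near=> m' e' => -[Km' _] /(_ D) /=.
  have e'e : e' <= e by near: e'; exact: nbhs_right_le.
  move=> /(_ (cut_anti e'e cD)) Dm'.
  case: (cD) => _ _ /(_ m' m Dm' (conj Km Dm)); rewrite leNgt => /negP; apply.
  by rewrite distrC; near: m'; exact: (@cvgr_dist_lt _ _ _ (nbhs m) _ id m).
move=> /(_ h) H; near (0:R)^'+ => e.
have Me : K `&` ~` (U `|` W) `<=` [set m | ~ chain_component e x m] by near: e.
have es : e <= s by near: e; exact: nbhs_right_le.
have e0 : 0 < e by [].
have gUW : gap s U W by exact: gap_thicken.
(* points across a boundary of this set inside the chain component would lie
   on both sides of the gap between [U] and [W] *)
have cutU : cut e x (chain_component e x `&` U).
  split; first by move=> z [/(_ K) + _]; apply; exact: cut_self.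
    by split; [exact: Qx|exact: sub_thicken].
  move=> u v [Cu Uu] [Kv CUv].
  have [Cv|Cv] := pselect (chain_component e x v); last first.
    by apply: (@gap_chain_component e x).
  apply: (le_trans es); apply: gUW => //; apply: contrapT => Wv.
  by apply: (Me v) => //; split => // -[Uv|//]; apply: CUv.
have Qy : Q y by exact: sub Ey.
have [_ Uy] := Qy e e0 _ cutU.
have := gUW y y Uy (sub_thicken s0 Ey).
by rewrite subrr normr0 leNgt s0.
Unshelve. all: by end_near. Qed.

(** Otherwise [y] would be in the quasi-component of [x], which is connected. *)
Lemma compact_disconnects_gap x y : compact K -> K x -> ~ connects K x y ->
  exists (D : set V) (e : R),
    [/\ 0 < e, D `<=` K, D x, ~ D y & gap e D (K `\` D)].
Proof.
move=> cK Kx nxy; apply: contrapT => h; apply: nxy.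
exists (quasi_component x); last first.
  move=> e e0 D cD; apply: contrapT => Dy; apply: h; exists D, e.
  by case: cD.
split; [by move=> e _ D []| |exact: connected_quasi_component].
exact: quasi_component_sub.
Qed.

End QuasiComponent.

(** * Antipodally symmetric sets *)

Section Antipodal.
Variables (R : realType) (V : normedModType R).
Implicit Types (A C Y U : set V) (x y z : V).

Lemma antipodally_symmetricP A :
  antipodally_symmetric A <-> forall x, A x -> A (- x).
Proof.
split=> [AE x Ax|sA]; first by rewrite -AE; exists x.
apply/seteqP; split=> [_ [x Ax <-]|x Ax]; first exact: sA.
by exists (- x); [exact: sA|rewrite opprK].
Qed.

Lemma closure_opp A C z : (forall x, A x -> C (- x)) ->
  closure A z -> closure C (- z).
Proof.
move=> AC Az B nB; have nB' : nbhs z (-%R @^-1` B).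
  by have := @opp_continuous V z; apply.
by have [w [Aw Bw]] := Az _ nB'; exists (- w); split => //; exact: AC.
Qed.

Lemma connects_sub Y U x y : Y `<=` U -> connects Y x y -> connects U x y.
Proof.
move=> YU [C [Cx CY Cc] Cy]; exists C => //.
by split => //; exact: subset_trans YU.
Qed.

Lemma connectsN A x y : antipodally_symmetric A ->
  connects A x y -> connects A (- x) (- y).
Proof.
move=> /antipodally_symmetricP sA [C [Cx CA Cc] Cy].
exists (-%R @` C); last by exists y.
split; [by exists x|by move=> _ [z Cz <-]; exact/sA/CA|].
apply: connected_continuous_connected => //; apply: continuous_subspaceT.
exact: opp_continuous.
Qed.

(** Opposite components of [A] are distinct, and [s] says whether the component
    of a point is the one chosen from its pair. *)
Lemma antipodal_sign A : antipodally_symmetric A ->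
  (forall x, ~ connects A x (- x)) ->
  exists s : V -> bool, forall x y, A x ->
    (connects A x y -> s x = s y) /\ (connects A x (- y) -> s x = ~~ s y).
Proof.
move=> sA nA; have sAP := (antipodally_symmetricP A).1 sA.
pose C := connected_component A.
(* the candidates are the same for [x] and [- x], hence so is the choice *)
pose c x := xget set0 [set D | D = C x \/ D = C (- x)].
have cN x : c (- x) = c x.
  rewrite /c; congr xget.
  by apply/seteqP; split => D /=; rewrite opprK; case;
    [right|left|right|left].
have cE x : c x = C x \/ c x = C (- x).
  by rewrite /c; case: xgetP => [D _ //|/(_ (C x)) h]; exfalso; apply: h; left.
pose s x := `[< c x = C x >].
have sE x y : A x -> connects A x y -> s x = s y.
  move=> Ax xy; have Cxy : C x = C y by exact: same_connected_component.
  have CNxy : C (- x) = C (- y).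
    by apply: same_connected_component; exact: connectsN.
  by rewrite /s /c Cxy CNxy.
have sN x : A x -> s (- x) = ~~ s x.
  move=> Ax; have ne : C x <> C (- x).
    move=> e; apply: (nA x); rewrite /connects -/(C x) e.
    exact/connected_component_refl/sAP.
  rewrite /s cN; case: (cE x) => ->.
    by rewrite (asboolT (erefl _)) asboolF.
  by rewrite (asboolT (erefl _)) asboolF// => /esym.
exists s => x y Ax; split=> xy; first exact: sE.
have Ay : A y.
  by rewrite -(opprK y); apply: sAP; exact: connected_component_sub xy.
by rewrite (sE _ _ Ax xy) sN.
Qed.

End Antipodal.

(** * Paths *)

Section Paths.
Variables (R : realType) (T : topologicalType).
Implicit Types (Y U : set T) (x y z : T).

Lemma path_connects_sub Y U x y : Y `<=` U ->
  path_connects R Y x y -> path_connects R U x y.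
Proof.
move=> YU [g [gc g0 g1 gY]]; exists g.
by split => //; exact: subset_trans YU.
Qed.

Lemma path_connects_connects Y x y : path_connects R Y x y -> connects Y x y.
Proof.
move=> [g [gc g0 g1 gY]]; exists (g @` `[0, 1]).
  split => //; first by exists 0; rewrite //= in_itv/= lexx ler01.
  by apply: connected_continuous_connected => //; exact: segment_connected.
by exists 1; rewrite //= in_itv/= lexx ler01.
Qed.

Lemma path_connects_refl Y x : Y x -> path_connects R Y x x.
Proof.
move=> Yx; exists (fun=> x); split => //; last by move=> _ [t _ <-].
by apply: continuous_subspaceT => t; exact: cvg_cst.
Qed.

Lemma path_connects_trans Y y x z :
  path_connects R Y x y -> path_connects R Y y z -> path_connects R Y x z.
Proof.
move=> [g [gc g0 g1 gY]] [h [hc h0 h1 hY]].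
pose k t := if t <= 1 / 2 then g (2 * t) else h (2 * t - 1).
have kg t : t <= 1 / 2 -> k t = g (2 * t) by rewrite /k => ->.
have kh t : 1 / 2 <= t -> k t = h (2 * t - 1).
  rewrite /k le_eqVlt => /orP[/eqP <-|tgt]; last by rewrite leNgt tgt.
  by rewrite lexx mul1r divff// subrr g1 h0.
have aff_c (a b : R) : continuous (fun t : R => a * t + b).
  move=> t; apply: (@cvgD _ _ _ (nbhs t)); last exact: cvg_cst.
  by apply: (@cvgM _ _ (nbhs t)); [exact: cvg_cst|exact: cvg_id].
(* each half of [k] is an affine reparametrization of a path on [0, 1] *)
have comp (f : R -> T) (a b u v : R) : {within `[0, 1], continuous f} ->
    (forall t, t \in `[u, v] -> a * t + b \in `[(0:R), 1]) ->
    (forall t, t \in `[u, v] -> k t = f (a * t + b)) ->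
    {within `[u, v], continuous k}.
  move=> fc ab kf; apply/subspace_continuousP => t tuv.
  rewrite /from_subspace kf//.
  have /subspace_continuousP /(_ (a * t + b) (ab _ tuv)) fct := fc.
  apply: cvg_trans fct => P /= nP.
  have := aff_c a b t _ nP; rewrite /within/= !nbhs_simpl/=.
  by apply: filterS => r + ruv; rewrite kf//; apply; exact: ab.
exists k; split.
- have -> : `[(0:R), 1]%classic = `[0, 1 / 2] `|` `[1 / 2, 1].
    by apply/seteqP; split => t /=; rewrite !in_itv/=; lra.
  apply: withinU_continuous; [exact: interval_closed|exact: interval_closed| | ].
    apply: (comp g 2 0) => // t; rewrite in_itv/= => t01.
      by rewrite in_itv/=; lra.
    by rewrite addr0 kg//; lra.
  apply: (comp h 2 (-1)) => // t; rewrite in_itv/= => t01.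
    by rewrite in_itv/=; lra.
  by rewrite kh//; lra.
- by rewrite kg ?mulr0//; lra.
- by rewrite kh; [rewrite mulr1 (_ : 2 - 1 = 1)//; lra|lra].
- move=> _ [t /= + <-]; rewrite in_itv/= => /andP[t0 t1].
  have [t2|t2] := leP t (1 / 2).
    rewrite kg//; apply: gY; exists (2 * t) => //=; rewrite in_itv/=; lra.
  rewrite kh ?ltW//; apply: hY; exists (2 * t - 1) => //=; rewrite in_itv/=; lra.
Qed.

(** Under local path connectedness, the points of a connected set [C] that can
    be reached from [x] form a set that is open and closed in [C]. *)
Lemma connects_path_connects (A : set T) :
  (forall y, A y -> \forall z \near y,
    A z -> path_connects R A y z /\ path_connects R A z y) ->
  forall x y, connects A x y -> path_connects R A x y.
Proof.
move=> loc x y [C [Cx CA Cc] Cy].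
pose P := [set z | path_connects R A x z].
have near_iff z : A z -> \forall w \near z, A w -> (P w <-> P z).
  move=> Az; apply: filterS (loc z Az) => w h Aw; have [zw wz] := h Aw.
  by split=> [xw|xz]; [exact: path_connects_trans xw wz|
                      exact: path_connects_trans xz zw].
suff : C `&` P = C by move=> CE; have [] : (C `&` P) y by rewrite CE.
apply: Cc; first by exists x; split => //; exact/path_connects_refl/CA.
  exists [set z | \forall w \near z, A w -> P w].
    rewrite openE => z /= h; exact: nbhs_interior.
  apply/seteqP; split => z [Cz Pz]; split => //.
    by apply: filterS (near_iff z (CA z Cz)) => w h Aw; exact/h.
  by have /nbhs_singleton := Pz; apply; exact: CA.
exists (~` [set z | \forall w \near z, A w -> ~ P w]).
  apply: open_closedC; rewrite openE => z /= h; exact: nbhs_interior.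
apply/seteqP; split => z [Cz Pz]; split => //.
  by move=> /nbhs_singleton; apply => //; exact: CA.
apply: contrapT => nP; apply: Pz => /=.
by apply: filterS (near_iff z (CA z Cz)) => w h Aw Pw; apply: nP; exact/(h Aw).
Qed.

End Paths.

(** * Caps of the sphere *)

Section SpherePaths.
Variables (R : realType) (d : nat).
Local Notation S := (unit_sphere R d).
Implicit Types x y : 'rV[R]_d.+1.

(** The segment from [x] to [y] stays in the ball of radius [e < 1] around [x],
    so it avoids the origin, and projecting it radially to the sphere moves its
    points by at most another [e]. *)
Lemma sphere_path x y (e : R) : S x -> S y -> e < 1 -> l2dist x y <= e ->
  path_connects R (S `&` [set z | l2dist x z <= e *+ 2]) x y.
Proof.
rewrite /unit_sphere/= => Sx Sy e1 xye.
pose z (t : R) := x + t *: (y - x).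
pose g t := (l2norm (z t))^-1 *: z t.
have zx t : 0 <= t <= 1 -> l2dist x (z t) <= e.
  move=> /andP[t0 t1]; rewrite l2distC /l2dist /z addrAC subrr add0r.
  rewrite l2normZ ger0_norm//.
  rewrite -/(l2dist y x) l2distC (le_trans _ xye)//.
  by rewrite ler_piMl// l2norm_ge0.
have zn t : 0 <= t <= 1 -> `|1 - l2norm (z t)| <= e.
  by move=> t01; rewrite -Sx (le_trans (ler_l2dist_dist _ _))// zx.
have zpos t : 0 <= t <= 1 -> 0 < l2norm (z t).
  by move=> /zn; rewrite ler_norml => /andP[_]; lra.
have zc : continuous z.
  move=> t; apply: (@cvgD _ _ _ (nbhs t)); first exact: cvg_cst.
  by apply: (@cvgZr_tmp _ _ _ (nbhs t)); exact: cvg_id.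
exists g; split.
- apply: continuous_in_subspaceT => t /set_mem /=; rewrite in_itv/= => t01.
  have lc : l2norm (z s) @[s --> t] --> l2norm (z t).
    apply: (@continuous_comp _ _ _ z (@l2norm R _)); first exact: zc.
    exact: l2norm_continuous.
  apply: (@cvgZ _ _ _ (nbhs t)); last exact: zc.
  by apply: (@cvgV _ _ (nbhs t)) => //; rewrite gt_eqF// zpos.
- by rewrite /g /z scale0r addr0 Sx invr1 scale1r.
- by rewrite /g /z scale1r addrC subrK Sy invr1 scale1r.
- move=> _ [t /= + <-]; rewrite in_itv/= => t01; split.
    by rewrite /g l2normZ normfV gtr0_norm ?zpos// mulVf// gt_eqF// zpos.
  apply: (le_trans (l2dist_triangle (z t) _ _)); rewrite mulr2n lerD ?zx//.
  (* the radial projection moves [z t] by [`|1 - l2norm (z t)|] *)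
  rewrite l2distC /l2dist /g -[X in _ - X]scale1r -scalerBl l2normZ.
  rewrite -[X in _ * X](gtr0_norm (zpos _ t01)) -normrM mulrBl mulVf ?mul1r ?zn//.
  by rewrite gt_eqF// zpos.
Qed.

(** The product neighbourhood lets the radius be chosen uniformly around [x]. *)
Lemma open_in_l2ball (A : set 'rV[R]_d.+1) x : open_in S A -> A x ->
  \forall x' \near x & e \near (0:R)^'+,
  S `&` [set z | l2dist x' z <= e] `<=` A.
Proof.
move=> [AS /open_subspaceP[U oU UA]] Ax.
have Ux : U x by have [] : (U `&` S) x by rewrite UA; split => //; exact: AS.
have /nbhs_ballP[r /= r0 rU] : nbhs x U by exact: open_nbhs_nbhs.
near=> x' e => /= z [Sz /= x'z].
suff [] : (A `&` S) z by [].
rewrite -UA; split => //; apply: rU; rewrite -ball_normE/=.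
apply: (le_lt_trans (norm_le_l2norm _)); rewrite -/(l2dist x z).
apply: (le_lt_trans (l2dist_triangle x' _ _)).
have e2 : e < r / 2 by near: e; apply: nbhs_right_lt; exact: divr_gt0.
have : l2dist x x' < r / 2 by near: x'; apply: near_l2dist_lt; exact: divr_gt0.
move: x'z e2; lra.
Unshelve. all: by end_near. Qed.

Lemma open_in_connects_path_connects (A : set 'rV[R]_d.+1) x y :
  open_in S A -> connects A x y -> path_connects R A x y.
Proof.
move=> oA; apply: connects_path_connects => {}y Ay.
have [[U E] /= [nU nE] UE] := open_in_l2ball oA Ay.
near (0:R)^'+ => e.
have He z : U z -> S `&` [set t | l2dist z t <= e] `<=` A.
  by move=> Uz; apply: (UE (z, e)); split => //=; near: e.
have e1 : e < 1 by near: e; apply: nbhs_right_lt.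
have e0 : 0 < e by [].
(* [sphere_path] loses a factor 2 *)
have conn z w : A z -> A w -> S `&` [set t | l2dist z t <= e] `<=` A ->
    l2dist z w <= e / 2 -> path_connects R A z w.
  move=> Az Aw zA zw; have AS : A `<=` S by case: oA.
  apply: (path_connects_sub _ (sphere_path (AS _ Az) (AS _ Aw) _ zw)); last by lra.
  by rewrite (_ : e / 2 *+ 2 = e)// mulr2n; lra.
near=> z => Az; have yz : l2dist y z <= e / 2.
  by apply: ltW; near: z; apply: near_l2dist_lt; exact: divr_gt0.
split; first by apply: conn => //; apply: He; exact: nbhs_singleton.
by apply: conn => //; [apply: He; near: z|rewrite l2distC].
Unshelve. all: by end_near. Qed.

End SpherePaths.

(** * Balanced colourings of the Borsuk signed graph *)

Lemma exactly_one_end_inE (G : signed_graph) (X : set (vertex G)) (e : edge G)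
    (x y : vertex G) : ends e = [set x; y] ->
  `[< exactly_one_end_in X e >] = `[< X x >] (+) `[< X y >].
Proof.
move=> exy; rewrite /exactly_one_end_in exy; apply/asboolP/idP.
- move=> [[u [[->|->] Xu]] [v [[->|->] Xv]]] //.
    by rewrite (asboolT Xu) (asboolF Xv).
  by rewrite (asboolT Xu) (asboolF Xv).
- case: (pselect (X x)) => Xx; case: (pselect (X y)) => Xy.
  + by rewrite (asboolT Xx) (asboolT Xy).
  + by move=> _; split; [exists x; split => //; left|exists y; split => //; right].
  + by move=> _; split; [exists y; split => //; right|exists x; split => //; left].
  + by rewrite (asboolF Xx) (asboolF Xy).
Qed.

Lemma ends_induced (G : signed_graph) (B : set (vertex G))
    (e : edge (Defs.induced B)) (x y : vertex (Defs.induced B)) :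
  ends (sval e) = [set sval x; sval y] -> ends e = [set x; y].
Proof.
move=> exy; rewrite /= exy; apply/seteqP; split => v /=.
  move=> [] /eq_sig_hprop h; [left|right]; apply: h => *;
    exact: Prop_irrelevance.
by move=> [] ->; [left|right].
Qed.

Section Colouring.
Variables (R : realType) (d : nat) (eps : R).
Local Notation G := (borsuk_signed_graph d eps).
Local Notation point := (sphere_point R d).

(** The switchings of the colour classes live on disjoint sets of points, so
    they merge into one function [s]; an edge inside a class becomes positive
    when [s] differs at its ends exactly if the edge was negative. *)
Lemma borsuk_colourableP p : balanced_colourable G p <->
  exists (f : point -> 'I_p) (s : point -> bool), forall x y, f x = f y ->
    (l2dist (sval x) (sval y) <= eps -> s x = s y) /\
    (l2dist (sval x) (- sval y) <= eps -> s x = ~~ s y).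
Proof.
split.
- move=> [f fB]; exists f.
  pose X i := projT1 (cid (fB i)).
  have XP i : all_positive (switch (X i)) := projT2 (cid (fB i)).
  pose s (x : point) :=
    `[< exists H : (f @^-1` [set f x]) x, X (f x) (exist _ x H) >].
  (* membership in the class is a proof argument of the switching [X i] *)
  have sE x i (H : (f @^-1` [set i]) x) : s x = `[< X i (exist _ x H) >].
    have fx : f x = i by exact: H.
    subst i; apply/asboolP/asboolP => [[H' h]|h]; last by exists H.
    by rewrite (Prop_irrelevance H H').
  have edgeP x y (b : bool) : f x = f y ->
      (if b then l2dist (sval x) (- sval y) <= eps
       else l2dist (sval x) (sval y) <= eps) -> s x = b (+) s y.
    move=> fxy dxy.
    have sp : @borsuk_edge_spec R d eps (b, [set x; y]) by exists x, y.
    have sub : [set x; y] `<=` f @^-1` [set f x].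
      by move=> z [->|->] /=.
    have Hx : (f @^-1` [set f x]) x by [].
    have Hy : (f @^-1` [set f x]) y by rewrite /preimage/= fxy.
    pose e : edge (Defs.induced (G := G) (f @^-1` [set f x])) :=
      exist _ (exist _ _ sp : edge G) sub.
    have ee : ends e = [set exist _ x Hx; exist _ y Hy] by exact: ends_induced.
    have := XP (f x) e; rewrite /= (exactly_one_end_inE _ ee).
    rewrite (sE x _ Hx) (sE y _ Hy).
    by case: (b); case: `[< X _ (exist _ x _) >]; case: `[< _ >].
  exists s => x y fxy; split => dxy; first exact: (edgeP x y false).
  exact: (edgeP x y true).
- move=> [f [s fs]]; exists f => i.
  exists [set v | s (sval v)] => e.
  case: (svalP (sval e)) => x [y [exy dxy]].
  have sub := svalP e.
  have Hx : (f @^-1` [set i]) x by apply: sub; rewrite /= exy; left.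
  have Hy : (f @^-1` [set i]) y by apply: sub; rewrite /= exy; right.
  have ee : ends e = [set exist _ x Hx; exist _ y Hy] by exact: ends_induced.
  rewrite /= (exactly_one_end_inE _ ee) /= !asboolb.
  have [pos neg] := fs x y (etrans Hx (esym Hy)).
  case: (sval (sval e)).1 dxy => [/neg|/pos] ->; by case: (s y).
Qed.

Lemma borsuk_colourableW p q : (p <= q)%N ->
  balanced_colourable G p -> balanced_colourable G q.
Proof.
move=> pq /borsuk_colourableP[f [s fs]]; apply/borsuk_colourableP.
by exists (widen_ord pq \o f), s => x y /(congr1 val) /= /val_inj; exact: fs.
Qed.

(** The sign is that of the chosen coordinate [i]: two points of one class with
    different signs differ by at least [2 / d.+1] in that coordinate. *)
Lemma borsuk_colourable : 0 < eps -> eps <= d.+1%:R^-1 ->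
  balanced_colourable G d.+1.
Proof.
move=> eps0 epsd; apply/borsuk_colourableP.
have big (x : point) : exists i, d.+1%:R^-1 <= `|sval x 0 i|.
  (* some coordinate realizes the sup norm *)
  have : 1 <= d.+1%:R * `|sval x|.
    by rewrite -[leLHS](svalP x) l2norm_le_norm.
  have [-> | xn0 h] := eqVneq (`|sval x|) 0; first by rewrite mulr0 ler10.
  have [[i j] xi] := mx_norm_neq0 xn0; exists j.
  rewrite -[leLHS]mul1r ler_pdivrMr// mulrC (le_trans h)//.
  by rewrite [X in _ * X]xi/= (ord1 i).
have [f fP] := choice big.
exists f, (fun x : point => 0 < sval x 0 (f x)) => x y fxy.
have := fP x; have := fP y; rewrite -fxy.
set i := f x; set c := d.+1%:R^-1 in epsd *.
have c0 : 0 < c by rewrite invr_gt0.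
move=> yi xi; split => dxy.
  have : `|(sval x - sval y) 0 i| <= eps.
    exact: le_trans (coord_le_l2norm _ _) dxy.
  rewrite !mxE; move: xi yi; rewrite !ler_normr !ler_norml => xi yi xy.
  by apply/idP/idP; move: xi yi xy => /orP[] xi /orP[] yi /andP[]; lra.
have : `|(sval x - - sval y) 0 i| <= eps.
  exact: le_trans (coord_le_l2norm _ _) dxy.
rewrite !mxE; move: xi yi; rewrite !ler_normr !ler_norml -leNgt => xi yi xy.
by apply/idP/idP; move: xi yi xy => /orP[] xi /orP[] yi /andP[]; lra.
Qed.

End Colouring.

(** * Colourings and covers of the sphere *)

Section Covers.
Variables (R : realType) (d k : nat).
Local Notation S := (unit_sphere R d).
Local Notation point := (sphere_point R d).
Implicit Type A : 'I_k -> set 'rV[R]_d.+1.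

Lemma open_cover_lebesgue A : sphere_cover A -> (forall i, open_in S (A i)) ->
  \forall e \near (0:R)^'+, forall x, S x ->
    exists i, S `&` [set z | l2dist x z <= e] `<=` A i.
Proof.
move=> cA oA.
apply: ((compact_near_coveringP S).1 (@compact_sphere R d) R (0^'+)
  (fun e x => exists i, S `&` [set z | l2dist x z <= e] `<=` A i) _) => x Sx.
have [i _ Ax] : (\bigcup_i A i) x by rewrite cA.
by apply: filterS (open_in_l2ball (oA i) Ax) => -[x' e] /= h; exists i.
Qed.

(** A point [x] gets a colour [i] such that [A i] contains the cap of radius
    [e] around [x]. For [eps] at most [e / 2], a point [y] at distance at most
    [eps] from [x] is joined to [x] by an arc in this cap, so the odd function
    on [A i] given by [antipodal_sign] takes the same value at both; for
    nearly antipodal points apply this to [x] and [- y]. *)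
Lemma sphere_cover_colourable A : sphere_cover A ->
  (forall i, open_in S (A i)) -> (forall i, antipodally_symmetric (A i)) ->
  (forall i, ~ connects_antipodal_pair (A i)) ->
  \forall eps \near (0:R)^'+, balanced_colourable (borsuk_signed_graph d eps) k.
Proof.
move=> cA oA sA nA; have L := open_cover_lebesgue cA oA.
near (0:R)^'+ => e.
have Le x : S x -> exists i, S `&` [set z | l2dist x z <= e] `<=` A i.
  by move: x; near: e.
have e0 : 0 < e by [].
near=> eps; apply/borsuk_colourableP.
have eps0 : 0 < eps by [].
have eps1 : eps < 1 by near: eps; exact: nbhs_right_lt.
have epse : eps *+ 2 <= e.
  rewrite -mulr_natr -ler_pdivlMr//; near: eps; apply: nbhs_right_le.
  exact: divr_gt0.
have [f fP] := choice (fun x : point => Le _ (svalP x)).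
have sgn i : exists s : 'rV[R]_d.+1 -> bool, forall x y, A i x ->
    (connects (A i) x y -> s x = s y) /\
    (connects (A i) x (- y) -> s x = ~~ s y).
  by apply: antipodal_sign => // x xx; apply: (nA i); exists x.
have [s sP] := choice sgn.
have conn (x : point) y : S y -> l2dist (sval x) y <= eps ->
    connects (A (f x)) (sval x) y.
  move=> Sy xy; apply: (@path_connects_connects R).
  apply: path_connects_sub (sphere_path (svalP x) Sy eps1 xy).
  by move=> z [Sz /= xz]; apply: fP; split => //=; exact: le_trans epse.
exists f, (fun x => s (f x) (sval x)) => x y fxy; rewrite -fxy.
have Ax : A (f x) (sval x).
  by apply: fP; split; [exact: svalP|rewrite /= l2distxx ltW].
have [pos neg] := sP (f x) (sval x) (sval y) Ax.
split => xy; [apply: pos|apply: neg]; apply: conn => //; first exact: svalP.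
exact/unit_sphereN/svalP.
Unshelve. all: by end_near. Qed.

(** Flipping the points of negative sign turns a colour class into a set [P]
    whose points are all more than [eps] away from those of [N = - P]: any
    closer pair would be an edge that the signs do not balance. Closures keep
    the gap. *)
Lemma colourable_closed_cover (eps : R) : 0 < eps ->
  balanced_colourable (borsuk_signed_graph d eps) k ->
  exists F : 'I_k -> set 'rV[R]_d.+1,
    [/\ sphere_cover F, forall i, closed_in S (F i),
    forall i, antipodally_symmetric (F i) &
    forall i, ~ connects_antipodal_pair (F i)].
Proof.
move=> eps0 /borsuk_colourableP[f [s fs]].
pose r (x : point) := if s x then sval x else - sval x.
have rS x : S (r x).
  by rewrite /r; case: ifP => _; [|apply: unit_sphereN]; exact: svalP.
pose P i := [set r x | x in f @^-1` [set i]].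
pose N i := [set - r x | x in f @^-1` [set i]].
have far x y : f x = f y -> eps < l2dist (r x) (- r y).
  move=> fxy; rewrite ltNge; apply/negP.
  have [pos neg] := fs x y fxy; rewrite /r.
  case: ifPn => sx; case: ifPn => sy; rewrite ?opprK ?l2distNN => dxy.
  - by have := neg dxy; rewrite sx sy.
  - by have := pos dxy; rewrite sx (negbTE sy).
  - by have := pos dxy; rewrite (negbTE sx) sy.
  - rewrite -{1}(opprK (sval y)) l2distNN in dxy.
    by have := neg dxy; rewrite (negbTE sx) (negbTE sy).
have PN i : gap (eps / d.+1%:R) (closure (P i)) (closure (N i)).
  apply: gap_closure => _ _ [x /= fx <-] [y /= fy <-].
  rewrite ler_pdivrMr// mulrC; apply: le_trans (l2norm_le_norm _).
  by apply: ltW; apply: far; rewrite fx fy.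
have NN i z : closure (P i) z -> closure (N i) (- z).
  by apply: closure_opp => _ [x fx <-]; exists x.
have NP i z : closure (N i) z -> closure (P i) (- z).
  by apply: closure_opp => _ [x fx <-]; exists x; rewrite ?opprK.
exists (fun i => closure (P i) `|` closure (N i)).
have FS i : closure (P i) `|` closure (N i) `<=` S.
  rewrite -closureU => z Pz; apply: closed_sphere.
  apply: closureS Pz => _ [] [x _ <-]; [exact: rS|exact/unit_sphereN/rS].
split.
- apply/seteqP; split => [x [i _]|x Sx]; first exact: FS.
  pose p : point := exist _ x Sx.
  exists (f p) => //; case sp: (s p); [left|right]; apply: subset_closure.
    by exists p => //; rewrite /r sp.
  by exists p => //; rewrite /r sp opprK.
- move=> i; split; first exact: FS.
  by apply: closed_subspaceW; apply: closedU; exact: closed_closure.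
- by move=> i; apply/antipodally_symmetricP => x [/NN|/NP]; [right|left].
- move=> i [x xx]; have d0 : 0 < eps / d.+1%:R :> R by rewrite divr_gt0.
  have [Px|Nx] : (closure (P i) `|` closure (N i)) x.
  + by case: xx => C [Cx CF _] _; exact: CF.
  + exact: (gap_disconnects d0 (PN i) _ Px (NN _ _ Px) xx).
  + apply: (gap_disconnects d0 (gapC (PN i)) _ Nx (NP _ _ Nx) xx).
    by rewrite setUC.
Qed.

End Covers.

(** * Neighbourhoods of symmetric closed sets *)

Section Neighbourhoods.
Variables (R : realType) (d : nat).
Local Notation S := (unit_sphere R d).
Implicit Types F U : set 'rV[R]_d.+1.

Lemma open_in_symmetric_core U : open_in S U ->
  open_in S (U `&` -%R @^-1` U) /\ antipodally_symmetric (U `&` -%R @^-1` U).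
Proof.
move=> [US /open_subspaceP[W oW WU]]; split; last first.
  by apply/antipodally_symmetricP => x [Ux UNx]; split => //=; rewrite opprK.
split; first by move=> x [/US].
apply/open_subspaceP; exists (W `&` -%R @^-1` W).
  apply: openI => //; apply: open_comp => // x _; exact: opp_continuous.
have h x : S x -> (W x <-> U x).
  by move=> Sx; have := congr1 (fun A => A x) WU => /= E; split => Hx;
    [have [] : (U `&` S) x by rewrite -WU|have [] : (W `&` S) x by rewrite WU].
by apply/seteqP; split => x [[x1 x2] Sx]; (split; [split|]) => //;
  apply/h => //; exact: unit_sphereN.
Qed.

Lemma closed_in_closed F : closed_in S F -> closed F.
Proof.
move=> [FS /closed_subspaceP[W cW WF]].
by rewrite -(setIidl FS) -WF; apply: closedI => //; exact: closed_sphere.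
Qed.

(** For a point [x] of [F], a cut of [F] between [x] and [- x] has a gap, which
    remains between the thickened sides and also parts the antipodal pairs near
    [x]. A point outside [F] has a neighbourhood that thin thickenings of [F]
    miss. Compactness of the sphere gives one thickness for all points. *)
Lemma closed_in_nbhs_disconnects F : closed_in S F -> antipodally_symmetric F ->
  ~ connects_antipodal_pair F ->
  exists U, [/\ open_in S U, F `<=` U & ~ connects_antipodal_pair U].
Proof.
move=> cF sF nF; have clF := closed_in_closed cF; have FS := cF.1.
have cpF : compact F by apply: subclosed_compact FS => //; exact: compact_sphere.
have H := (compact_near_coveringP S).1 (@compact_sphere R d) R (0^'+)
  (fun e x => ~ connects (S `&` thicken e F) x (- x)) _.
have {}H : \forall e \near (0:R)^'+,
    S `<=` [set x | ~ connects (S `&` thicken e F) x (- x)].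
  apply: H => x Sx.
  have [Fx|nFx] := pselect (F x); last first.
    have /nbhs_ballP[r /= r0 rF] : nbhs x (~` F).
      by apply: open_nbhs_nbhs; split => //; exact: closed_openC.
    near=> x' e => /= -[C [Cx' /(_ _ Cx') [_ [a Fa x'a] _] _]].
    apply: (rF a) => //; rewrite -ball_normE/=.
    have xx' : `|x - x'| < r / 2.
      near: x'; apply: (@cvgr_dist_lt _ _ _ (nbhs x) _ id x) => //.
      exact: divr_gt0.
    have er : e < r / 2 by near: e; apply: nbhs_right_lt; exact: divr_gt0.
    have := ler_distD x' x a; move: x'a xx' er => /=; lra.
  have nxx : ~ connects F x (- x) by move=> xx; apply: nF; exists x.
  have [D [r [r0 DF Dx DNx gD]]] := compact_disconnects_gap cpF Fx nxx.
  pose t := r / 3; have t0 : 0 < t by rewrite divr_gt0.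
  have gt : gap t (thicken t D) (thicken t (F `\` D)).
    by apply: gap_thicken; rewrite -[t *+ 3]mulr_natr divfK.
  near=> x' e => /=.
  have xx' : `|x' - x| < t.
    rewrite distrC; near: x'; exact: (@cvgr_dist_lt _ _ _ (nbhs x) _ id x).
  have et : e <= t by near: e; exact: nbhs_right_le.
  apply: (gap_disconnects t0 gt).
  + move=> z [_ [a Fa za]].
    have [Da|Da] := pselect (D a); [left|right]; exists a => //;
      exact: lt_le_trans et.
  + by exists x.
  + exists (- x); last by rewrite -opprD normrN.
    by split => //; exact: (antipodally_symmetricP F).1 sF _ Fx.
near (0:R)^'+ => e; exists (S `&` thicken e F); split.
- split; first by move=> x [].
  by apply/open_subspaceP; exists (thicken e F); [exact: open_thicken|
    rewrite setIAC setIid setIC].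
- by move=> x Fx; split; [exact: FS|apply: sub_thicken].
- move=> [x xx]; have [C [Cx CU _] _] := xx; have [Sx _] := CU x Cx.
  have He : S `<=` [set x | ~ connects (S `&` thicken e F) x (- x)] by near: e.
  exact: He xx.
Unshelve. all: by end_near. Qed.

End Neighbourhoods.

Theorem theorem20 (R : realType) (d : nat) (d_gt0 : (0 < d)%N) :
  [<->
    (* (a) *)
    exists eps_d : R, 0 < eps_d /\
      forall eps : R, 0 < eps -> eps <= eps_d -> eps < 2 ->
        balanced_chromatic_number (borsuk_signed_graph d eps) d.+1;
    (* (b) *)
    forall A : 'I_d -> set 'rV[R]_d.+1,
      sphere_cover A ->
      (forall i, open_in (unit_sphere R d) (A i)) ->
      (forall i, antipodally_symmetric (A i)) ->
      exists i, connects_antipodal_pair (A i);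
    (* (c1) *)
    forall F : 'I_d -> set 'rV[R]_d.+1,
      sphere_cover F ->
      (forall i, closed_in (unit_sphere R d) (F i)) ->
      (forall i, antipodally_symmetric (F i)) ->
      exists i, forall U : set 'rV[R]_d.+1,
        open_in (unit_sphere R d) U -> F i `<=` U ->
        connects_antipodal_pair U;
    (* (c2) *)
    forall F : 'I_d -> set 'rV[R]_d.+1,
      sphere_cover F ->
      (forall i, closed_in (unit_sphere R d) (F i)) ->
      (forall i, antipodally_symmetric (F i)) ->
      exists i, connects_antipodal_pair (F i)]
  /\
  (* the parenthetical claim in (b) *)
  (forall A : set 'rV[R]_d.+1,
      open_in (unit_sphere R d) A -> antipodally_symmetric A ->
      forall x, connects A x (- x) -> path_connects R A x (- x)).
Proof.
split; last by move=> A oA _ x; exact: open_in_connects_path_connects.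
tfae.
- move=> [eps_d [eps_d0 chi]] A cA oA sA; apply: contrapT => /forallNP nA.
  have col := sphere_cover_colourable cA oA sA nA.
  near (0:R)^'+ => eps.
  have eps1 : eps <= eps_d by near: eps; exact: nbhs_right_le.
  have eps2 : eps < 2 by near: eps; exact: nbhs_right_lt.
  have eps0 : 0 < eps by [].
  have [_ /(_ d)] := chi eps eps0 eps1 eps2.
  by rewrite ltnn => h; suff : false by []; apply: h; near: eps.
- move=> B F cF clF sF; apply: contrapT => /forallNP nF.
  have {}nF i : exists U, [/\ open_in (unit_sphere R d) U, F i `<=` U
      & ~ connects_antipodal_pair U].
    apply: contrapT => h; apply: (nF i) => U oU FU.
    by apply: contrapT => nU; apply: h; exists U.
  have [U UP] := choice nF.
  have [i [x xx]] : exists i, connects_antipodal_pair (U i `&` -%R @^-1` U i).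
    apply: B => [|i|i].
    + apply/seteqP; split => [x [i _ [Ux _]]|x].
        by have [[US _] _ _] := UP i; exact: US.
      rewrite -cF => -[i _ Fx]; exists i => //; have [_ FU _] := UP i.
      by split; apply: FU => //; exact: (antipodally_symmetricP (F i)).1.
    + by have [/open_in_symmetric_core[]] := UP i.
    + by have [/open_in_symmetric_core[]] := UP i.
  have [_ _] := UP i; apply; exists x; apply: connects_sub xx; exact: subIsetl.
- move=> C1 F cF clF sF; have [i Fi] := C1 F cF clF sF; exists i.
  apply: contrapT => /(closed_in_nbhs_disconnects (clF i) (sF i))[U [oU FU]].
  by apply; exact: Fi.
- move=> C2; exists d.+1%:R^-1; split; first by rewrite invr_gt0.
  move=> eps eps0 epsd _; split; first exact: borsuk_colourable.
  move=> q colq; rewrite ltnNge; apply/negP => qd.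
  have [F [cF clF sF nF]] :=
    colourable_closed_cover eps0 (borsuk_colourableW qd colq).
  by have [i /nF] := C2 F cF clF sF.
Unshelve. all: by end_near. Qed.
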